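(* Let $\lambda$ be an infinite cardinal such that $\lambda\leq 2^{\aleph_0}$ and $\mathrm{Pr}^{\bigstar}(\lambda)$ holds. Then $\mathcal{K}\mathcal{L}(\lambda,\omega)$ holds (and hence $\mathcal{K}\mathcal{L}(\lambda,2)$ holds).
   Context: Kalikow property: for cardinals $\lambda,\kappa$, $\mathcal{K}\mathcal{L}(\lambda,\kappa)$ holds if there is a sequence $\langle F_n:n<\omega\rangle$ of functions $F_n:{}^{n}\lambda\to\kappa$ such that, if $F:{}^{\omega}\lambda\to{}^{\omega}\kappa$ is defined by $F(\eta)(n)=F_n(\eta\restriction n)$ for all $\eta\in{}^\omega\lambda$ and $n\in\omega$, then for all $\eta,\nu\in{}^{\omega}\lambda$: ($\eta(n)=\nu(n)$ for all but finitely many $n$) if and only if ($F(\eta)(n)=F(\nu)(n)$ for all but finitely many $n$). Here ${}^{n}\lambda$ is the set of sequences of length $n$ of elements of $\lambda$, and ${}^{\omega}\lambda$ is the set of $\omega$-sequences of elements of $\lambda$. $\mathcal{K}\mathcal{L}(\lambda,\omega)$ is the case $\kappa=\aleph_0$. The property $\mathrm{Pr}^{\bigstar}$: an algebra $M$ on $\lambda$ is a structure with universe $\lambda$ whose vocabulary consists of finitary function symbols (individual constants allowed); for $X\subseteq\lambda$, $\mathrm{cl}_M(X)$ is the closure of $X$ under the functions of $M$. For an algebra $M$ on $\lambda$ the following conditions are equivalent: $(\bigstar)^0_M$: for each sequence $\langle\alpha_n:n\in\omega\rangle$ of elements of $\lambda$, for all but finitely many $n$ we have $\alpha_n\in\mathrm{cl}_M(\{\alpha_k:n<k<\omega\})$;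 $(\bigstar)^1_M$: there is no sequence $\langle A_n:n\in\omega\rangle$ of countably infinite subsets of $\lambda$ such that $\mathrm{cl}_M(A_{n+1})\subsetneq\mathrm{cl}_M(A_n)$ for all $n\in\omega$; $(\bigstar)^2_M$: for every $A\in[\lambda]^{\aleph_0}$ there is $B\in[A]^{\aleph_0}$ such that $\mathrm{cl}_M(B)=\mathrm{cl}_M(C)$ for every $C\in[B]^{\aleph_0}$ (where $[X]^{\aleph_0}$ is the set of countably infinite subsets of $X$). $\mathrm{Pr}^{\bigstar}(\lambda)$ means that there is an algebra $M$ on $\lambda$ with vocabulary of cardinality at most $\aleph_0$ satisfying one (equivalently, all) of the conditions $(\bigstar)^i_M$, $i<3$. *)

(* Defs.v *)
From mathcomp Require Import all_boot.
From mathcomp Require Import boolp classical_sets functions cardinality.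

Set Implicit Arguments.
Unset Strict Implicit.
Unset Printing Implicit Defensive.

Local Open Scope classical_set_scope.
Local Open Scope card_scope.

(* A cardinal lambda is represented by a type L of that cardinality: every
   notion below is invariant under bijections. *)

Definition almost_equal (T : Type) (u v : nat -> T) : Prop :=
  finite_set [set n | u n <> v n].

Definition restr (T : Type) (eta : nat -> T) (n : nat) : n.-tuple T :=
  [tuple eta i | i < n].

(* The property KL(lambda, kappa). *)
Definition Kalikow (L K : Type) : Prop :=
  exists Fn : forall n : nat, n.-tuple L -> K,
    let F (eta : nat -> L) : nat -> K := fun n => Fn n (restr eta n) in
    forall eta nu : nat -> L,
      almost_equal eta nu <-> almost_equal (F eta) (F nu).

(* Function symbols of arity 0 are the individual constants. *)
Record algebra (L : Type) : Type := Algebra {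
  symbol : Type;
  arity : symbol -> nat;
  interp : forall f : symbol, (arity f).-tuple L -> L
}.

Definition closed_under (L : Type) (M : algebra L) (Y : set L) : Prop :=
  forall (f : symbol M) (a : (arity f).-tuple L),
    (forall i, Y (tnth a i)) -> Y (interp a).

Definition cl (L : Type) (M : algebra L) (X : set L) : set L :=
  smallest (closed_under M) X.

(* [X]^{aleph_0} *)
Definition aleph0_subsets (T : Type) (X : set T) : set (set T) :=
  [set B | B `<=` X /\ B #= [set: nat]].

Definition star0 (L : Type) (M : algebra L) : Prop :=
  forall alpha : nat -> L,
    finite_set
      [set n | ~ cl M [set alpha k | k in [set k | (n < k)%N]] (alpha n)].

Definition star1 (L : Type) (M : algebra L) : Prop :=
  ~ exists A : nat -> set L,
      (forall n, aleph0_subsets [set: L] (A n)) /\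
      (forall n, cl M (A n.+1) `<` cl M (A n)).

Definition star2 (L : Type) (M : algebra L) : Prop :=
  forall A : set L, aleph0_subsets [set: L] A ->
    exists2 B : set L, aleph0_subsets A B &
      forall C : set L, aleph0_subsets B C -> cl M B = cl M C.

(* The three conditions are equivalent for every algebra, so the disjunction
   only leaves open which of them is verified. *)
Definition Pr_star (L : Type) : Prop :=
  exists M : algebra L,
    countable [set: symbol M] /\ (star0 M \/ star1 M \/ star2 M).

(* Main.v *)
Require Import Defs.
From mathcomp Require Import all_boot.
From mathcomp Require Import boolp classical_sets functions cardinality.

(** Almost every entry of a sequence [eta] lies in the closure of the later
    entries, so it is the value of a term in finitely many later entries.  The
    vocabulary being countable, terms may be numbered so that the term number
    [p], evaluated at [eta k.+1, ..., eta (p - 1)], gives [eta k]; the least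
    such [p] is the code of [eta] at [k] ([star0_enumeration],
    [eventually_least_code]).  It depends on [eta k, eta k.+1, ...] only.

    [F_n] must be insensitive to a change of an initial part of [eta], so the
    data that it reports about [eta] have to forget [eta k] sooner or later.
    Say that [k] is released at stage [n] when [n] exceeds [k] and the code [p]
    at [k] for the first time.  Stage [n] reports, for each [c] released at
    [n], the code at [c] and information on the entries [eta i] with
    [c <= i < n] alone.  Each [k] is released at most once, so only finitely
    many stages report anything that involves a given initial part: sequences
    that agree almost everywhere get the same reports almost always
    ([info_invariant]).

    The information reported about [eta c, ..., eta (n - 1)] is the following.
    The elements of [L] are identified with distinct 0-1 sequences.  Given a
    guess [theta i] of the code at each [i < c], one can evaluate terms
    downwards from [c - 1] and obtain guesses for the earlier entries; for each
    of the finitely many [theta] with values at most [n], the first bits of the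
    resulting values are reported.  No guess is privileged, as the true codes at
    places below [c] may depend on entries that must be forgotten.

    Conversely, let [eta] and [nu] have the same reports from stage [N] on.
    The code at [k] is reported at the stage at which [k] is released, hence
    [eta] and [nu] have the same codes from some [K] on.  Given [k >= K] and a
    bit [b], take the least [c >= K] that is released after the stages [k] and
    [b], say at stage [n].  All places between [K] and [c] have been released
    before, so their codes are at most [n], and the report of stage [n] for the
    [theta] made of these codes contains the bit [b] of [eta k] and of [nu k].
    Hence [eta k = nu k] ([info_separates]).

    Finally, [nat] can be replaced by [bool]: a sequence [u] of numbers is
    determined up to finitely many entries by its graph as a subset of a
    countable set, up to finitely many elements ([Kalikow_bool]). *)

Set Implicit Arguments.
Unset Strict Implicit.
Unset Printing Implicit Defensive.

Local Open Scope classical_set_scope.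
Local Open Scope card_scope.

(** * Finite sets of natural numbers *)

Lemma finite_set_natP (S : set nat) :
  finite_set S <-> exists N, forall n, N <= n -> ~ S n.
Proof.
split=> [/finite_seqP[s ->]|[N SN]].
  exists (\max_(i <- s) i).+1 => n ltn /= ns.
  by have := @leq_bigmax_seq _ s xpredT id n ns isT; rewrite leqNgt ltn.
apply: (sub_finite_set _ (finite_II N)) => n Sn /=.
by rewrite ltnNge; apply/negP => /SN.
Qed.

Lemma almost_equalP (T : Type) (u v : nat -> T) :
  almost_equal u v <-> exists N, forall n, N <= n -> u n = v n.
Proof.
rewrite /almost_equal finite_set_natP; split=> -[N H]; exists N => n /H.
  by move/contrapT.
by move=> E /(_ E).
Qed.

(** * The three forms of the closure condition *)

Section Equivalence.

Variables (L : Type) (M : algebra L).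

Lemma cl_sub (X Y : set L) : X `<=` Y -> cl M X `<=` cl M Y.
Proof. by move=> XY x Xx Z [cZ YZ]; apply: Xx; split=> // y /XY /YZ. Qed.

(** The places [k] where [alpha k] escapes the closure of the later entries
    form an infinite set on which [alpha] cannot repeat a value, as a repeated
    value belongs to the later entries.  Both other conditions are refuted on
    this set. *)
Lemma not_star0_sequence : ~ star0 M -> exists (alpha : nat -> L) (S : set nat),
  [/\ infinite_set S,
      forall k, S k -> ~ cl M [set alpha j | j in [set j | k < j]] (alpha k) &
      {in S &, injective alpha}].
Proof.
move=> /existsNP[alpha Hinf].
exists alpha, [set n | ~ cl M [set alpha k | k in [set k | (n < k)%N]] (alpha n)].
split=> // j k /set_mem Sj /set_mem Sk E; apply/eqP; rewrite eqn_leq.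
apply/andP; split; rewrite leqNgt; apply/negP => lt.
  by apply: Sk; rewrite -E; apply: sub_gen_smallest; exists j.
by apply: Sj; rewrite E; apply: sub_gen_smallest; exists k.
Qed.

Lemma injective_image_nat (T : Type) (f : nat -> T) (S : set nat) :
  {in S &, injective f} -> infinite_set S -> f @` S #= [set: nat].
Proof.
move=> fI Sinf; apply: card_eq_trans (inj_card_eq fI) _.
by apply: eq_card_nat => //; exact: sub_countable (subset_card_le (subsetT _)) _.
Qed.

(** The tails of a sequence of places as above have strictly decreasing
    closures. *)
Lemma star1_star0 : star1 M -> star0 M.
Proof.
move=> star1M; apply: contrapT => /not_star0_sequence[alpha [S [Sinf Sout Sinj]]].
have /choice[next nextP] : forall n, exists k, S k /\ n < k.
  move=> n; apply: contrapT => nex; apply: Sinf; apply/finite_set_natP.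
  by exists n.+1 => k nk Sk; apply: nex; exists k.
pose s n := iter n.+1 next 0.
have Ss n : S (s n) by case: (nextP (iter n next 0)).
have ltsS n : s n < s n.+1 by case: (nextP (s n)).
apply: star1M; exists (fun n => alpha @` (S `&` [set j | s n <= j])); split=> n.
  split=> //; apply: injective_image_nat.
    by move=> x y /set_mem[Sx _] /set_mem[Sy _]; apply: Sinj; rewrite inE.
  move=> /finite_set_natP[N HN]; apply: Sinf; apply/finite_set_natP.
  exists (maxn N (s n)) => k; rewrite geq_max => /andP[Nk nk] Sk.
  by apply: (HN k Nk).
split; first apply: cl_sub => _ [j [Sj nj]] <-.
  by exists j => //; split=> //; exact: leq_trans (ltnW (ltsS n)) nj.
move=> /(_ (alpha (s n))) sub; apply: (Sout (s n)) => //.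
apply: cl_sub (sub _) => [_ [j [Sj nj] <-]|]; last first.
  by apply: sub_gen_smallest; exists (s n) => //; split=> //=.
by exists j => //=; exact: leq_trans nj.
Qed.

(** In a subset [B] of the image of the bad places, the element at the least
    place is not in the closure of the others, so removing it changes the
    closure. *)
Lemma star2_star0 : star2 M -> star0 M.
Proof.
move=> star2M; apply: contrapT => /not_star0_sequence[alpha [S [Sinf Sout Sinj]]].
have [B [BA Bnat] BP] := star2M (alpha @` S)
  (conj (@subsetT _ _) (injective_image_nat Sinj Sinf)).
have Binf : infinite_set B.
  by rewrite (eq_finite_set Bnat); exact: infinite_nat.
have exB : exists i, `[< S i /\ B (alpha i) >].
  have [b Bb] := infinite_setN0 Binf.
  by have [i Si E] := BA _ Bb; exists i; apply/asboolP; rewrite E.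
case: (ex_minnP exB) => i /asboolP[Si Bi] imin.
have /BP E : aleph0_subsets B (B `\ alpha i).
  split; first by move=> x [].
  apply: eq_card_nat.
    have Bcount : countable B by rewrite /countable (card_le_eql Bnat).
    by apply: sub_countable Bcount; apply: subset_card_le => x [].
  exact: infinite_setD.
apply: (Sout i Si); have : cl M B (alpha i) by exact: sub_gen_smallest.
rewrite E; apply: cl_sub => b [Bb bi].
have [j Sj jb] := BA _ Bb; exists j => //=.
rewrite ltn_neqAle; apply/andP; split; last by apply/imin/asboolP; rewrite jb.
by apply/eqP => ij; apply: bi; rewrite -jb ij.
Qed.

End Equivalence.

(** * Enumerating the terms of a countable algebra *)

Section Window.

Variables (L : Type) (d : L).

Definition window (a b : nat) (eta : nat -> L) : nat -> L :=
  fun i => if a <= i < b then eta i else d.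

Lemma eq_window (a b : nat) (eta nu : nat -> L) :
  (forall i, a <= i < b -> eta i = nu i) -> window a b eta = window a b nu.
Proof. by move=> E; apply/funext => i; rewrite /window; case: ifP => // /E. Qed.

End Window.

(** A generic tree is a term: leaves are variables, and a node labelled [j]
    applies the operation number [j], which takes a list of any length. *)
Section Terms.

Variables (L : Type) (g : nat -> seq L -> L).

Fixpoint eval (env : nat -> L) (t : GenTree.tree nat) : L :=
  match t with
  | GenTree.Leaf i => env i
  | GenTree.Node j ts => g j (map (eval env) ts)
  end.

Lemma eval_finitary (t : GenTree.tree nat) :
  exists N, forall env env', (forall i, i < N -> env i = env' i) ->
    eval env t = eval env' t.
Proof.
elim: t => [i|j ts IH] /=; first by exists i.+1 => env env'; apply.
have [N HN] : exists N, forall env env', (forall i, i < N -> env i = env' i) ->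
    map (eval env) ts = map (eval env') ts.
  elim: ts IH => [_|t ts IHts /= [[N1 H1] /IHts[N2 H2]]]; first by exists 0.
  exists (maxn N1 N2) => env env' E.
  rewrite (H1 env env') ?(H2 env env') // => i lt; apply: E.
    by rewrite leq_max lt orbT.
  by rewrite leq_max lt.
by exists N => env env' /HN ->.
Qed.

End Terms.

Section Enumeration.

Variables (L : Type) (d : L) (M : algebra L).
Hypothesis cM : countable [set: symbol M].

(** Made total on lists, the operations of any arity become labels of nodes of
    generic trees, whose terms form a countable type. *)
Lemma coded_operations : exists g : nat -> seq L -> L,
  forall f : symbol M, exists j, forall a : (arity f).-tuple L,
    interp a = g j a.
Proof.
have [code codeI] := elimT pcard_injP cM.
pose P j (l : seq L) (b : L) :=
  exists f (a : (arity f).-tuple L), [/\ code f = j, tval a = l & b = interp a].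
have /choice[g gP] : forall jl : nat * seq L, exists b,
    (exists b', P jl.1 jl.2 b') -> P jl.1 jl.2 b.
  move=> [j l]; case: (pselect (exists b', P j l b')) => [[b Pb]|nP].
    by exists b.
  by exists d.
exists (fun j l => g (j, l)) => f; exists (code f) => a.
have [|f' [a' [/= cf aa ->]]] := gP (code f, tval a).
  by exists (interp a), f, a.
have ff : f' = f by apply: codeI; rewrite ?inE.
by subst f'; congr interp; exact/val_inj.
Qed.

(** The operation number [p] evaluates one fixed term, and each term has
    infinitely many numbers.  Hence the arguments may be cut off at [p]: a large
    enough number of the right term is beyond all of its variables. *)
Lemma star0_enumeration : star0 M -> exists e : nat -> (nat -> L) -> L,
  forall eta, exists K, forall k, K <= k ->
    exists p, e p (window d k.+1 p eta) = eta k.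
Proof.
move=> star0M; have [g gP] := coded_operations.
(* The second component only serves to give each term infinitely many
   numbers. *)
pose code : countType := (GenTree.tree nat * nat)%type.
exists (fun p env => if (unpickle p : option code) is Some (t, _)
  then eval g env t else d) => eta.
have /finite_set_natP[K KP] := star0M eta; exists K => k /KP /contrapT ck.
pose above i := if k < i then eta i else d.
have [t tE] : exists t, eval g above t = eta k.
  apply: (ck [set a | exists t, eval g above t = a]); split=> [f a aP|_ [j /= kj <-]]; last first.
    by exists (GenTree.Leaf j); rewrite /= /above kj.
  have [ts tsP] := choice aP; have [j ->] := gP f.
  exists (GenTree.Node j [seq ts i | i <- enum 'I_(arity f)]) => /=.
  congr g; rewrite -map_comp -[in RHS](map_tnth_enum a).
  by apply: eq_map => i /=; rewrite tsP.
have [N NP] := eval_finitary g t.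
have codeI : injective (fun j : nat => pickle ((t, j) : code)).
  by move=> i j /(pcan_inj pickleK)[].
have [j Nj] := injective_gtn codeI N.
exists (pickle ((t, j) : code)); rewrite pickleK -tE; apply: NP => i iN.
by rewrite /window /above (ltn_trans iN Nj) andbT.
Qed.

End Enumeration.

(** * Reports that determine a sequence up to finitely many entries *)

Section Kalikow_code.

Variables (L : Type) (d : L) (x : L -> nat -> bool) (e : nat -> (nat -> L) -> L).
Hypothesis x_inj : injective x.
Hypothesis e_code : forall eta, exists K, forall k, K <= k ->
  exists p, e p (window d k.+1 p eta) = eta k.

Definition least_code (k p : nat) (eta : nat -> L) : Prop :=
  e p (window d k.+1 p eta) = eta k /\
  forall q, q < p -> e q (window d k.+1 q eta) <> eta k.

(** [n] is the first stage beyond [k] and beyond its code [p], so that the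
    report of stage [n], which sees [eta] below [n] only, can establish that
    [p] is the code. *)
Definition released (k p n : nat) (eta : nat -> L) : Prop :=
  least_code k p eta /\ n = (maxn p k).+1.

(** The order is descending because the operation that gives the entry at [k]
    takes later entries as arguments, which have to be recovered first. *)
Fixpoint recover (theta : nat -> nat) (c : nat) (env : nat -> L) : nat -> L :=
  if c is k.+1 then
    recover theta k (fun i => if i == k
      then e (theta k) (window d k.+1 (theta k) env) else env i)
  else env.

(** A query consists of a place [c], a code [p] for it, guessed codes [theta],
    and a place and a bit number for the recovered sequence. *)
Definition query (n : nat) : Type :=
  ('I_n.+1 * 'I_n.+1 * {ffun 'I_n.+1 -> 'I_n.+1} * 'I_n.+1 * 'I_n.+1)%type.

Definition answer (n : nat) (eta : nat -> L) (z : query n) : option bool :=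
  let: (c, p, theta, k, b) := z in
  if `[< released c p n eta >] then
    Some (x (recover (fun i => theta (inord i)) c (window d c n eta) k) b)
  else None.

Definition info (n : nat) (eta : nat -> L) : {ffun query n -> option bool} :=
  [ffun z : query n => answer eta z].

Lemma least_code_uniq (k p q : nat) (eta : nat -> L) :
  least_code k p eta -> least_code k q eta -> p = q.
Proof.
move=> [ep pmin] [eq qmin]; apply/eqP; rewrite eqn_leq.
apply/andP; split; rewrite leqNgt; apply/negP => lt; first exact: pmin lt eq.
exact: qmin lt ep.
Qed.

Lemma least_code_ext (k p n : nat) (eta nu : nat -> L) : k < n -> p <= n ->
    (forall i, k <= i < n -> eta i = nu i) ->
  least_code k p eta -> least_code k p nu.
Proof.
move=> kn pn E.
have W q : q <= p -> window d k.+1 q eta = window d k.+1 q nu.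
  move=> qp; apply: eq_window => i /andP[ki iq]; apply: E.
  by rewrite (ltnW ki) (leq_trans iq) // (leq_trans qp).
have Ek : eta k = nu k by apply: E; rewrite leqnn.
rewrite /least_code (W p) // Ek => -[-> pmin]; split=> // q qp.
by rewrite -W ?(ltnW qp) //; exact: pmin.
Qed.

Lemma released_ext (k p n : nat) (eta nu : nat -> L) :
    (forall i, k <= i < n -> eta i = nu i) ->
  released k p n eta -> released k p n nu.
Proof.
move=> E [lc nE]; split=> //; apply: (least_code_ext _ _ E lc); rewrite nE.
  by rewrite ltnS leq_maxr.
by rewrite leqW ?leq_maxl.
Qed.

(** A report is a function of the entries at and after the places released at
    its stage.  With [m = 0] this says that [info n eta] depends on [eta] below
    [n] only. *)
Lemma info_tail (m n : nat) (eta nu : nat -> L) :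
    (forall i, m <= i < n -> eta i = nu i) ->
    (forall k p, k < m -> ~ released k p n eta /\ ~ released k p n nu) ->
  info n eta = info n nu.
Proof.
move=> E out; apply/ffunP => -[[[[c p] theta] k] b]; rewrite !ffunE /answer.
have [cm|mc] := ltnP c m.
  by have [rn rn'] := out _ p cm; rewrite !asboolF.
have E' i : c <= i < n -> eta i = nu i.
  by move=> /andP[ci i_n]; apply: E; rewrite (leq_trans mc ci).
rewrite (eq_window d E'); congr (if _ then _ else _).
by apply: asbool_equiv_eq; split; apply: released_ext => // i /E' ->.
Qed.

Lemma released_bounded (m : nat) (eta : nat -> L) :
  exists N, forall n k p, N <= n -> k < m -> ~ released k p n eta.
Proof.
elim: m => [|m [N NP]]; first by exists 0.
have [N' NP'] : exists N', forall n p, N' <= n -> ~ released m p n eta.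
  have [[p pm]|nop] := pselect (exists p, least_code m p eta); last first.
    by exists 0 => n p _ [pm _]; apply: nop; exists p.
  exists (maxn p m).+2 => n q lt [qm nE].
  by move: lt; rewrite nE (least_code_uniq pm qm) ltnn.
exists (maxn N N') => n k p; rewrite geq_max => /andP[Nn Nn'].
by rewrite ltnS leq_eqVlt => /predU1P[->|]; [exact: NP'|exact: NP].
Qed.

(** After the last stage at which a place below the last disagreement is
    released, the reports coincide. *)
Lemma info_invariant (eta nu : nat -> L) : almost_equal eta nu ->
  exists N, forall n, N <= n -> info n eta = info n nu.
Proof.
move=> /almost_equalP[m E].
have [N1 out1] := released_bounded m eta; have [N2 out2] := released_bounded m nu.
exists (maxn N1 N2) => n; rewrite geq_max => /andP[N1n N2n].
apply: (@info_tail m) => [i /andP[mi _]|k p km]; first exact: E.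
by split; [exact: out1|exact: out2].
Qed.

(** Correct codes from [K] on suffice to recover the entries from [K] on: the
    operation number [theta k] only looks at places between [k] and [n], which
    have been recovered before. *)
Lemma recoverP (theta : nat -> nat) (K n c : nat) (eta env : nat -> L) :
    (forall k, K <= k < c ->
       theta k <= n /\ e (theta k) (window d k.+1 (theta k) eta) = eta k) ->
    (forall i, maxn K c <= i < n -> env i = eta i) ->
  forall i, K <= i < n -> recover theta c env i = eta i.
Proof.
elim: c env => [|c IH] env code E i iKn /=; first by apply: E; rewrite maxn0.
apply: IH => // [k /andP[Kk kc]|{iKn}i]; first by apply: code; rewrite Kk ltnW.
rewrite geq_max -andbA => /and3P[Ki ci i_n]; case: eqVneq => [ic|ic]; last first.
  by apply: E; rewrite i_n geq_max Ki ltn_neqAle eq_sym ic ci.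
subst i; have [|tn <-] := code c; first by rewrite Ki leqnn.
congr e; apply: eq_window => i /andP[ci' it]; apply: E.
by rewrite geq_max (leq_trans Ki (ltnW ci')) ci' (leq_trans it tn).
Qed.

Lemma eventually_least_code (eta : nat -> L) :
  exists K, forall k, K <= k -> exists p, least_code k p eta.
Proof.
have [K KP] := e_code eta; exists K => k /KP[p0 p0P].
have exP : exists p, `[< e p (window d k.+1 p eta) = eta k >].
  by exists p0; apply/asboolP.
case: (ex_minnP exP) => p /asboolP pP pmin; exists p; split=> // q qp qP.
by move: (pmin q (asboolT qP)); rewrite leqNgt qp.
Qed.

Lemma info_released (n c p : nat) (theta : {ffun 'I_n.+1 -> 'I_n.+1})
    (k b : nat) (eta nu : nat -> L) :
    let rec u := recover (fun i => theta (inord i)) c (window d c n u) in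
    k < n -> b < n -> info n eta = info n nu -> released c p n eta ->
  released c p n nu /\ x (rec eta k) b = x (rec nu k) b.
Proof.
move=> rec kn bn E rel; have [_ nE] := rel.
have cn : c < n.+1 by rewrite nE !ltnS leqW ?leq_maxr.
have pn : p < n.+1 by rewrite nE !ltnS leqW ?leq_maxl.
pose z : query n := (Ordinal cn, Ordinal pn, theta,
  Ordinal (ltnW kn : k < n.+1), Ordinal (ltnW bn : b < n.+1)).
have := congr1 (fun f : {ffun query n -> option bool} => f z) E.
rewrite !ffunE /answer /= asboolT //.
by case: asboolP => // rel' [].
Qed.

(** The core of the argument, where the releases recorded in the reports are
    turned into common codes, and these into common entries. *)
Lemma info_separates (eta nu : nat -> L) :
    (exists N, forall n, N <= n -> info n eta = info n nu) ->
  almost_equal eta nu.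
Proof.
move=> [N Einfo]; apply/almost_equalP.
have [K1 code1] := eventually_least_code eta.
pose K := maxn N K1.
have /choice[p pP] : forall k, exists p, K <= k -> least_code k p eta.
  move=> k; have [/(leq_trans (leq_maxr _ _))/code1[q qk]|_] := leqP K k.
    by exists q.
  by exists 0.
(* The stage at which k is released. *)
pose t k := (maxn (p k) k).+1.
have kt k : k < t k by rewrite ltnS leq_maxr.
have pt k : p k <= t k by rewrite leqW ?leq_maxl.
have rel k : K <= k -> released k (p k) (t k) eta by move=> /pP.
have report k : K <= k -> info (t k) eta = info (t k) nu.
  move=> Kk; apply: Einfo; apply: leq_trans (ltnW (kt k)).
  by apply: leq_trans Kk; rewrite leq_maxl.
have pP' k : K <= k -> least_code k (p k) nu.
  move=> Kk; have t0 : 0 < t k by [].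
  by have [[]] := info_released [ffun=> ord0] t0 t0 (report k Kk) (rel k Kk).
exists K => k Kk; apply: x_inj; apply/funext => b.
pose B := maxn k b.
have exc : exists c, (K <= c) && (B < t c).
  by exists B; rewrite kt (leq_trans Kk (leq_maxl _ _)).
case: (ex_minnP exc) => c /andP[Kc Bt] cmin.
(* By minimality of c, the places between K and c are released by stage B. *)
have early i : K <= i < c -> p i <= t c.
  move=> /andP[Ki ic]; apply: leq_trans (pt i) _.
  rewrite leqNgt; apply/negP => lt.
  have := cmin i; rewrite Ki (ltn_trans Bt lt) => /(_ isT).
  by rewrite leqNgt ic.
pose theta := [ffun i : 'I_(t c).+1 => inord (p i) : 'I_(t c).+1].
have thetaE i : K <= i < c -> theta (inord i) = p i :> nat.
  move=> iKc; have ilt : i < (t c).+1.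
    by case/andP: iKc => _ ic; rewrite ltnW // ltnS (leq_trans ic (ltnW (kt c))).
  by rewrite ffunE inordK inordK // ltnS early.
have ktc : k < t c := leq_ltn_trans (leq_maxl _ _) Bt.
have btc : b < t c := leq_ltn_trans (leq_maxr _ _) Bt.
have rec u : (forall i, K <= i -> least_code i (p i) u) ->
    recover (fun i => theta (inord i)) c (window d c (t c) u) k = u k.
  move=> lc; apply: (@recoverP _ K (t c)); last by rewrite Kk.
    move=> i iKc; rewrite (thetaE _ iKc) (early _ iKc).
    by case/andP: iKc => Ki _; case: (lc i Ki).
  move=> i; rewrite geq_max -andbA => /and3P[_ ci it].
  by rewrite /window ci it.
have [_] := info_released theta ktc btc (report c Kc) (rel c Kc).
by rewrite !rec.
Qed.

Lemma Kalikow_of_enumeration : Kalikow L nat.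
Proof.
exists (fun n s => pickle (info n (nth d s))) => F eta nu.
have FE u n : F u n = pickle (info n u).
  congr pickle; apply: (@info_tail 0) => // i /andP[_ i_n].
  by rewrite -(tnth_nth d (restr u n) (Ordinal i_n)) tnth_mktuple.
split=> [/info_invariant[N NP]|/almost_equalP[N NP]].
  by apply/almost_equalP; exists N => n /NP; rewrite !FE => ->.
apply: info_separates; exists N => n /NP; rewrite !FE.
exact: (pcan_inj pickleK).
Qed.

End Kalikow_code.

(** * From number-valued to boolean-valued reports *)

(** The 2-adic valuation gives back [n], and the odd part [v]. *)
Definition pair_code (n v : nat) : nat := 2 ^ n * v.*2.+1.

Lemma pair_code_inj (n n' v v' : nat) :
  pair_code n v = pair_code n' v' -> n = n' /\ v = v'.
Proof.
have lg m w : logn 2 (pair_code m w) = m.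
  rewrite lognM ?expn_gt0 // pfactorK // lognE /= dvdn2 /= odd_double.
  by rewrite addn0.
move=> E; have nn : n = n' by rewrite -(lg n v) E lg.
split=> //; subst n'; move/eqP: E; rewrite eqn_mul2l expn_eq0 /=.
by rewrite eqSS => /eqP /double_inj.
Qed.

Lemma ltn_pair_code (n v : nat) : n < pair_code n v.
Proof.
by apply: leq_trans (ltn_expl n (ltnSn 1)) _; rewrite leq_pmulr.
Qed.

(** The boolean at [m] tells whether [m] is the code of a pair [(n, F eta n)],
    that is, a point of the graph of [F eta].  Codes exceed [n], so the entries
    of [eta] below [m] suffice to decide this.  A change of one value of
    [F eta] affects two codes only, and it does affect one. *)
Lemma Kalikow_bool (L : Type) : Kalikow L nat -> Kalikow L bool.
Proof.
move=> [Fn FnP].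
have [[d]|nL] := pselect (inhabited L); last first.
  by exists (fun _ _ => false) => F eta; case: nL; constructor; exact: eta 0.
pose F (eta : nat -> L) n := Fn n (restr eta n).
exists (fun m s => `[< exists2 n, n < m &
  m = pair_code n (Fn n (restr (nth d s) n)) >]) => G eta nu.
have GP u m : G u m <-> exists n, m = pair_code n (F u n).
  have rE n : n < m -> restr (nth d (restr u m)) n = restr u n.
    move=> nm; apply: eq_from_tnth => i; rewrite !tnth_mktuple.
    have im := ltn_trans (ltn_ord i) nm.
    by rewrite -(tnth_nth d (restr u m) (Ordinal im)) tnth_mktuple.
  split=> [/asboolP[n nm ->]|[n mE]]; first by exists n; rewrite rE.
  have nm : n < m by rewrite mE ltn_pair_code.
  by apply/asboolP; exists n; rewrite // rE.
have -> := FnP eta nu; rewrite -/(F eta) -/(F nu).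
split=> /almost_equalP[N NP]; apply/almost_equalP; last first.
  exists N => n Nn; pose m := pair_code n (F eta n).
  have : G nu m.
    rewrite -NP; first by apply/GP; exists n.
    exact: leq_trans Nn (ltnW (ltn_pair_code _ _)).
  by move=> /GP[n' /pair_code_inj[<- ->]].
(* Beyond these bounds no m codes a pair whose first component is below N. *)
pose bound u := \max_(n < N) pair_code n (F u n).
have late u m n : bound u < m -> m = pair_code n (F u n) -> N <= n.
  move=> bm mE; rewrite leqNgt; apply/negP => nN; move: bm.
  by rewrite mE ltnNge (leq_bigmax (Ordinal nN)).
exists (maxn (bound eta) (bound nu)).+1 => m; rewrite gtn_max => /andP[bm bm'].
apply/idP/idP => /GP[n mE]; apply/GP; exists n.
  by rewrite -NP //; exact: late mE.
by rewrite NP //; exact: late mE.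
Qed.

(** * The theorem *)

Theorem theorem3p6 (L : Type)
  (infL : infinite_set [set: L])
  (leL : [set: L] #<= [set: nat -> bool])
  (prL : Pr_star L) :
  Kalikow L nat /\ Kalikow L bool.
Proof.
suff KLnat : Kalikow L nat by split=> //; exact: Kalikow_bool.
have [M [cM stars]] := prL.
have star0M : star0 M by case: stars => [//|[/star1_star0|/star2_star0]].
have [x xI] := elimT pcard_injP leL.
have [d _] := infinite_setN0 infL.
have [e eP] := star0_enumeration d cM star0M.
by apply: (@Kalikow_of_enumeration L d x e) => // a b; apply: xI; rewrite inE.
Qed.
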